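(* Let $X$ be a real Banach space and let $f:\mathbb{R}\to X$ be arbitrary. Then there exists a set $N\subset\mathbb{R}$ of Lebesgue measure zero such that: if $x\in\mathbb{R}\setminus N$ and $\min(mD^-(f,x),mD^+(f,x))<\infty$, then $md(f,x)$ exists.
   Context: For $f:\mathbb{R}\to X$ and $x\in\mathbb{R}$: $mD^{\pm}(f,x)=\limsup_{t\to0+}\frac{\|f(x\pm t)-f(x)\|}{t}\in[0,+\infty]$. The unilateral metric derivatives are $md_{\pm}(f,x)=\lim_{t\to0+}\frac{\|f(x\pm t)-f(x)\|}{t}$ (when the limit exists). If $md_+(f,x)$ and $md_-(f,x)$ exist and are equal (as finite numbers), one says that the metric derivative $md(f,x)$ exists and sets $md(f,x)=md_+(f,x)$. *)

(* Defs.v *)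
From HB Require Import structures.
From mathcomp Require Import all_boot all_order all_algebra.
From mathcomp Require Import all_classical all_reals all_analysis.

Set Implicit Arguments.
Unset Strict Implicit.
Unset Printing Implicit Defensive.

Import Order.TTheory GRing.Theory Num.Theory.
Import numFieldNormedType.Exports.

Local Open Scope classical_set_scope.
Local Open Scope ring_scope.

Section metric_derivative.
Context {R : realType} {X : normedModType R}.
Implicit Types (f : R -> X) (x : R).

Definition mquot_plus f x (t : R) : R := `|f (x + t) - f x| / t.
Definition mquot_minus f x (t : R) : R := `|f (x - t) - f x| / t.

Definition mD_plus f x : \bar R :=
  limf_esup (fun t => (mquot_plus f x t)%:E) 0^'+.
Definition mD_minus f x : \bar R :=
  limf_esup (fun t => (mquot_minus f x t)%:E) 0^'+.

(* Convergence is in R, so these limits exist only as finite numbers; [md_plus]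
   and [md_minus] are meaningful only under the corresponding [_exists]. *)
Definition md_plus_exists f x : Prop := cvg (mquot_plus f x t @[t --> 0^'+]).
Definition md_minus_exists f x : Prop := cvg (mquot_minus f x t @[t --> 0^'+]).

Definition md_plus f x : R := lim (mquot_plus f x t @[t --> 0^'+]).
Definition md_minus f x : R := lim (mquot_minus f x t @[t --> 0^'+]).

Definition md_exists f x : Prop :=
  [/\ md_plus_exists f x, md_minus_exists f x & md_plus f x = md_minus f x].

End metric_derivative.

(* Main.v *)
Require Import Defs.
From HB Require Import structures.
From mathcomp Require Import finmap.
From mathcomp Require Import all_boot all_order all_algebra.
From mathcomp Require Import all_classical all_reals all_analysis.
From mathcomp Require Import measurable_realfun ring lra.

Import Order.TTheory GRing.Theory Num.Theory.
Import numFieldNormedType.Exports.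

Local Open Scope classical_set_scope.
Local Open Scope ring_scope.

(** Where a one-sided upper metric derivative is finite, [f] is, up to a countable
    decomposition of the points, Lipschitz on a small set [E], and its values off
    [E] are controlled by those at points of [E] lying just beside. By Vitali's
    covering theorem a set [B] each point of which lies in arbitrarily small
    intervals [J] with outer measure [mu (B `&` J) <= c |J|], [c < 1], is null;
    no measurability of [B] is required. This rules out, almost everywhere in
    [E], both gaps of [E] near [x] of size proportional to the distance to [x],
    and difference quotients along [E] that are infinitely often below [p] and
    infinitely often above [q > p]. So the quotients converge along [E], and
    then along all [y --> x], from both sides to the same limit. *)

(** * Outer Lebesgue measure and a Vitali covering theorem for closed intervals *)

Section OuterLebesgue.
Context {R : realType}.
Local Notation mu := (@lebesgue_measure R).
Local Open Scope ereal_scope.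

(** [mu] unfolds to the outer measure induced by [wlength], so monotonicity and subadditivity hold
    for non-measurable sets too. *)
Lemma lebesgue_outer_le (A B : set R) : A `<=` B -> mu A <= mu B.
Proof. exact: (@le_outer_measure _ _ ((@wlength R idfun)^*)%mu). Qed.

Lemma lebesgue_outerU (A B : set R) : mu (A `|` B) <= mu A + mu B.
Proof. exact: (@outer_measureU2 _ _ ((@wlength R idfun)^*)%mu). Qed.

Lemma lebesgue_outer_seq (T : Type) (s : seq T) (F : T -> set R) :
  mu (\big[setU/set0]_(i <- s) F i) <= \sum_(i <- s) mu (F i).
Proof.
elim: s => [|i s IH]; first by rewrite !big_nil measure0.
by rewrite !big_cons (le_trans (lebesgue_outerU _ _))// leeD2l.
Qed.

Lemma lebesgue_outer_open (A : set R) (e : R) : (0 < e)%R ->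
  exists U, [/\ open U, A `<=` U & mu U <= mu A + e%:E].
Proof. exact: outer_measure_open_le. Qed.

Lemma negligible_lebesgue_outer (A : set R) : mu A = 0 -> mu.-negligible A.
Proof. by move=> A0; apply/negligible_outer_measure. Qed.

Lemma lebesgue_measure_cc (a b : R) : (a <= b)%R ->
  mu `[a, b]%classic = (b - a)%:E.
Proof.
by rewrite le_eqVlt lebesgue_measure_itv/= lte_fin => /orP[/eqP ->|->]//;
  rewrite ltxx subrr.
Qed.

(* Closed intervals listed from left to right, with disjointness built in. *)
Definition itv_before (p q : R * R) : bool := (p.2 < q.1)%R.

(** Peel off the leftmost interval: by [itv_before] the others lie in what remains of [U]. *)
Lemma sum_length_le (s : seq (R * R)) (U : set R) :
  measurable U -> pairwise itv_before s ->
  (forall p, p \in s -> (p.1 < p.2)%R /\ `[p.1, p.2]%classic `<=` U) ->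
  (\sum_(p <- s) (p.2 - p.1))%:E <= mu U.
Proof.
elim: s U => [|p s IH] U mU; first by rewrite big_nil.
rewrite pairwise_cons => /andP[/allP ps pws] sU.
have [p12 pU] := sU p (mem_head _ _).
rewrite big_cons EFinD -lebesgue_measure_cc; last exact: ltW.
have -> : mu U = mu `[p.1, p.2]%classic + mu (U `\` `[p.1, p.2]%classic).
  rewrite -[in LHS](setUIDK U `[p.1, p.2]%classic) measureU//.
  - by rewrite (setIidr pU).
  - exact: measurableI.
  - exact: measurableD.
  - by apply/seteqP; split => // x /= [[_ ?] [_]].
apply: leeD2l; apply: IH => //; first exact: measurableD.
move=> q qs; have [|q12 qU] := sU q; first by rewrite inE qs orbT.
split=> // x xq; split; first exact: qU.
move: xq; rewrite /= !in_itv/= => /andP[qx _] /andP[_ xp].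
by have := ps _ qs; rewrite /itv_before ltNge (le_trans qx xp).
Qed.

(** Vitali's theorem will be applied to a sequence of balls, so arbitrary intervals are traded for
    slightly larger balls from a countable family. *)
Lemma rational_ball_approx (a b eta : R) : (a < b)%R -> (0 < eta)%R ->
  exists c r : rat, [/\ `[a, b]%classic `<=` ball (ratr c : R) (ratr r),
    (0 < ratr r :> R)%R & (2 * ratr r < b - a + eta)%R].
Proof.
move=> ab eta0.
(* The radius will exceed the half-length by more than [eta / 8], which absorbs the offset of the
   centre from the midpoint. *)
have [|c] := @rat_in_itvoo R ((a + b) / 2 - eta / 8) ((a + b) / 2 + eta / 8).
  by lra.
rewrite in_itv/= => /andP[c1 c2].
have [|r] := @rat_in_itvoo R ((b - a) / 2 + eta / 8) ((b - a) / 2 + eta / 4).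
  by lra.
rewrite in_itv/= => /andP[r1 r2].
exists c, r; split; [|lra|lra].
move=> x; rewrite /= in_itv/= => /andP[ax xb].
rewrite /ball/= ltr_norml; apply/andP; split; lra.
Qed.

Lemma closure_ball_diff_le (c r a b : R) : (a <= b)%R ->
  `[a, b]%classic `<=` ball c r ->
  mu (closure (ball c r) `\` `[a, b]%classic) <= (2 * r - (b - a))%:E.
Proof.
move=> ab abB.
have /abB : `[a, b]%classic a by rewrite /= in_itv/= lexx.
rewrite /ball/= ltr_norml => /andP[a1 a2].
have /abB : `[a, b]%classic b by rewrite /= in_itv/= ab lexx.
rewrite /ball/= ltr_norml => /andP[b1 b2].
have r0 : (0 < r)%R by lra.
apply: (@le_trans _ _ (mu (`[(c - r)%R, a]%classic `|` `[b, (c + r)%R]%classic))).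
  apply: lebesgue_outer_le => x [].
  move=> /(is_ball_closureP (is_ball_ball _ _)).
  rewrite cpoint_ball// radius_ball_num ?(ltW r0)// ler_norml => /andP[x1 x2].
  move=> /negP; rewrite /= !in_itv/= negb_and -!ltNge => /orP[xa|bx].
    by left; apply/andP; split; lra.
  by right; apply/andP; split; lra.
rewrite (le_trans (lebesgue_outerU _ _))// !lebesgue_measure_cc; [|lra..].
by rewrite -EFinD lee_fin; lra.
Qed.

(** Each admissible interval is enclosed in a rational ball exceeding it by at most the fraction
    [eta] of its length. Vitali's theorem for balls selects finitely many disjoint ones; shrinking
    them back to their intervals costs at most [eta * mu U] in total. *)
Lemma vitali_itv (A U : set R) (F : R -> R -> Prop) (e : R) :
  open U -> mu U < +oo -> A `<=` U ->
  (forall x, A x -> forall d : R, (0 < d)%R -> exists a b : R,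
    [/\ F a b, (a < b)%R, (a <= x <= b)%R & (b - a < d)%R]) ->
  (0 < e)%R ->
  exists s : seq (R * R), [/\ pairwise itv_before s,
    (forall p, p \in s ->
      [/\ F p.1 p.2, (p.1 < p.2)%R & `[p.1, p.2]%classic `<=` U]) &
    mu (A `\` \big[setU/set0]_(p <- s) `[p.1, p.2]%classic) <= e%:E].
Proof.
move=> oU Uoo AU AF e0.
have /fineK UM : mu U \is a fin_num by rewrite ge0_fin_numE// measure_ge0.
set M := fine (mu U) in UM.
have M0 : (0 <= M)%R by rewrite -lee_fin UM measure_ge0.
(* The total excess is then at most [eta * M <= e / 2]; the [+ 1] covers [M = 0]. *)
pose eta : R := (e / 2 / (M + 1))%R.
have eta0 : (0 < eta)%R by rewrite !divr_gt0//; lra.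
pose good (p : rat * rat) : bool := (0 < ratr p.2 :> R)%R.
(* Codes that give no ball of positive radius get the unit ball, since every radius must be
   positive. *)
pose Bl (i : nat) : set R := if unpickle i is Some p then
  (if good p then ball (ratr p.1 : R) (ratr p.2) else ball (0%R : R) 1%R)
  else ball (0%R : R) 1%R.
have ballBl i : is_ball (Bl i).
  by rewrite /Bl; case: unpickle => [p|]; [case: ifP|]; rewrite is_ball_ball.
have radBl i : (0 < (radius (Bl i))%:num)%R.
  rewrite /Bl; case: unpickle => [p|]; last by rewrite radius_ball_num.
  by case: ifPn => [p0|_]; rewrite radius_ball_num// ltW.
pose inner (i : nat) (p : R * R) := [/\ F p.1 p.2, (p.1 < p.2)%R,
  `[p.1, p.2]%classic `<=` Bl i &
  mu (closure (Bl i) `\` `[p.1, p.2]%classic) <= (eta * (p.2 - p.1))%:E].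
pose V : set nat := [set i | Bl i `<=` U /\ exists p, inner i p].
have cover : vitali_cover A Bl V.
  split=> // x Ax d d0.
  have [d' /= d'0 d'U] : exists2 d' : R, (0 < d')%R & ball x d' `<=` U.
    have /nbhs_ballP[d' /= d'0 H] := open_nbhs_nbhs (conj oU (AU _ Ax)).
    by exists d'.
  (* A ball of radius below [m] containing [x] has radius below [d] and stays inside [ball x d']. *)
  pose m := (Num.min d d' / 4)%R.
  have m0 : (0 < m)%R by rewrite divr_gt0// lt_min d0.
  have md : (4 * m <= d /\ 4 * m <= d')%R.
    by rewrite /m mulrCA divff// mulr1 !ge_min !lexx orbT.
  have [a [b [Fab ab /andP[ax xb] abm]]] := AF _ Ax _ m0.
  (* The first term of the minimum keeps the excess below [eta * (b - a)], the second keeps the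
     radius below [b - a < m]. *)
  have t0 : (0 < Num.min (eta * (b - a)) (b - a))%R.
    by rewrite lt_min mulr_gt0// ?subr_gt0.
  have [c [r [abcr r0 rlt]]] := rational_ball_approx _ _ _ ab t0.
  have [r1 r2] : (2 * ratr r - (b - a) <= eta * (b - a) /\
                  2 * ratr r < 2 * (b - a))%R.
    have : (Num.min (eta * (b - a)) (b - a) <= b - a)%R by rewrite ge_min lexx orbT.
    have : (Num.min (eta * (b - a)) (b - a) <= eta * (b - a))%R by rewrite ge_min lexx.
    move=> h1 h2; split; lra.
  have [i Blcr] : exists i, Bl i = ball (ratr c : R) (ratr r).
    by exists (pickle (c, r)); rewrite /Bl pickleK /good r0.
  have xcr : ball (ratr c : R) (ratr r) x by apply: abcr; rewrite /= in_itv/= ax.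
  exists i; rewrite Blcr; split => //; last first.
    by rewrite radius_ball_num ?(ltW r0)//; lra.
  split.
    rewrite Blcr => z; move: xcr; rewrite /ball/= => xcr zcr; apply: d'U.
    move: xcr zcr; rewrite /ball/= !ltr_norml => /andP[? ?] /andP[? ?].
    by apply/andP; split; lra.
  exists (a, b); split => //=; first by rewrite Blcr.
  rewrite Blcr (le_trans (closure_ball_diff_le _ _ _ _ (ltW ab) abcr))//.
have Aoo : mu A < +oo by rewrite (le_lt_trans (lebesgue_outer_le _ _ AU)).
have e20 : (0 < e / 2)%R by lra.
have [G [GV tG AG]] := vitali_theorem_corollary radBl Aoo cover e20.
have : forall k, exists p, k \in G -> inner k p.
  move=> k; have [kG|] := boolP (k \in G); last by exists (0, 0)%R.
  by have [_ [p]] := GV _ kG; exists p.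
move=> /choice[J JG].
pose s0 := [seq J k | k <- G].
pose s := sort (fun p q : R * R => (p.1 <= q.1)%R) s0.
have sE : perm_eq s s0 by rewrite perm_sort.
have sP p : p \in s -> exists2 k, k \in G & p = J k.
  by rewrite (perm_mem sE) => /mapP[k kG ->]; exists k.
have sG p : p \in s ->
    [/\ F p.1 p.2, (p.1 < p.2)%R & `[p.1, p.2]%classic `<=` U].
  move=> /sP[k kG ->]; have [FJ J12 JB _] := JG _ kG; split => //.
  by apply: (subset_trans JB); have [] := GV _ kG.
(* The closures of the selected balls are disjoint, so intervals with a common point have the same
   index. *)
have Jinj i j z : i \in G -> j \in G ->
    `[(J i).1, (J i).2]%classic z -> `[(J j).1, (J j).2]%classic z -> i = j.
  move=> iG jG zi zj; apply: tG => //; exists z.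
  have [_ _ JiB _] := JG _ iG; have [_ _ JjB _] := JG _ jG.
  by split; apply: subset_closure; [exact: JiB|exact: JjB].
have pws : pairwise itv_before s.
  have trs : transitive (fun p q : R * R => (p.1 <= q.1)%R).
    by move=> p q r; exact: le_trans.
  have : sorted (fun p q : R * R => (p.1 <= q.1)%R) s.
    by apply: sort_sorted => p q; exact: le_total.
  rewrite (sorted_pairwise trs) => st.
  have : uniq s.
    rewrite (perm_uniq sE) map_inj_in_uniq ?fset_uniq// => i j iG jG Jij.
    have [_ Ji _ _] := JG _ iG.
    by apply: (Jinj i j (J i).1) => //; rewrite -?Jij /= in_itv/= lexx ltW.
  rewrite uniq_pairwise => us.
  have : pairwise [rel p q : R * R | (p.1 <= q.1)%R && (p != q)] s.
    by rewrite pairwise_relI st us.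
  apply: (@sub_in_pairwise _ (mem s)); last exact/allP.
  (* If the later interval began before the earlier one ended, its left end would lie in both. *)
  move=> p q /sP[i iG ->] /sP[j jG ->] /= /andP[le_ij]; apply: contraNT.
  rewrite /itv_before -leNgt => ge_ij.
  have [_ Jj _ _] := JG _ jG.
  by rewrite (Jinj i j (J j).1)//= in_itv/= ?le_ij ?lexx ?(ltW Jj).
exists s; split => //.
have sumM : (\sum_(p <- s) (p.2 - p.1) <= M)%R.
  rewrite -lee_fin UM; apply: sum_length_le => //; first exact: open_measurable.
  by move=> p /sG[].
rewrite (perm_big _ sE)/= big_map.
rewrite (perm_big _ sE)/= big_map in sumM.
(* A point missed by the intervals is missed by the closed balls or lies in the excess of one of
   them; each contribution is at most [e / 2]. *)
apply: (@le_trans _ _ (mu ((A `\` \big[setU/set0]_(k <- G) closure (Bl k)) `|`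
    \big[setU/set0]_(k <- G)
      (closure (Bl k) `\` `[(J k).1, (J k).2]%classic)))).
  apply: lebesgue_outer_le => x [Ax xJ].
  have [xB|] := pselect ((\big[setU/set0]_(k <- G) closure (Bl k)) x); last by left.
  right; move: xB xJ; rewrite -!bigcup_seq => -[k kG xk] xJ.
  by exists k => //; split => // xJk; apply: xJ; exists k.
rewrite (le_trans (lebesgue_outerU _ _))//.
rewrite [e in e%:E](_ : _ = e / 2 + e / 2)%R; last by lra.
rewrite EFinD leeD ?(ltW AG)// (le_trans (lebesgue_outer_seq _ _ _))//.
apply: (@le_trans _ _ (\sum_(k <- G) (eta * ((J k).2 - (J k).1))%:E)).
  rewrite big_seq [leRHS]big_seq; apply: lee_sum => k kG.
  by have [] := JG _ kG.
rewrite sumEFin -mulr_sumr lee_fin (le_trans (ler_wpM2l (ltW eta0) sumM))//.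
by rewrite /eta mulrAC ler_pdivrMr; [rewrite ler_wpM2l//; lra|lra].
Qed.
End OuterLebesgue.

(** * Null sets from local thinness, and proportional gaps *)

Section NullSets.
Context {R : realType}.
Local Notation mu := (@lebesgue_measure R).

(** Take an open [U] containing [B] with [mu U <= mu B + e], and a Vitali family inside it covering
    [B] up to [e]: subadditivity gives [mu B <= e + c * (mu B + e)] for every [e > 0]. *)
Lemma locally_thin_null (B : set R) (c : R) : (mu B < +oo)%E -> 0 <= c < 1 ->
  (forall x, B x -> forall d : R, 0 < d -> exists a b : R,
    [/\ (mu (B `&` `[a, b]%classic) <= (c * (b - a))%:E)%E,
        a < b, a <= x <= b & b - a < d]) ->
  mu B = 0%E.
Proof.
move=> Boo /andP[c0 c1] thin.
have /fineK BM : mu B \is a fin_num by rewrite ge0_fin_numE// measure_ge0.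
set M := fine (mu B) in BM.
have M0 : 0 <= M by rewrite -lee_fin BM measure_ge0.
have key e : 0 < e -> (1 - c) * M <= 2 * e.
  move=> e0; have [U [oU BU Ule]] := lebesgue_outer_open B e e0.
  rewrite -BM -EFinD in Ule.
  have Uoo : (mu U < +oo)%E by rewrite (le_lt_trans Ule) ?ltry.
  have [s [pws sP sB]] := vitali_itv B U
    (fun a b => mu (B `&` `[a, b]%classic) <= (c * (b - a))%:E)%E
    e oU Uoo BU thin e0.
  have sumM : \sum_(p <- s) (p.2 - p.1) <= M + e.
    rewrite -lee_fin (le_trans _ Ule)//.
    apply: sum_length_le => //; first exact: open_measurable.
    by move=> p /sP[].
  suff : M <= e + c * (M + e) by nra.
  apply: (@le_trans _ _ (e + c * \sum_(p <- s) (p.2 - p.1))); last first.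
    by rewrite lerD2l ler_wpM2l.
  rewrite -lee_fin BM EFinD.
  apply: (@le_trans _ _ (mu
    ((B `\` \big[setU/set0]_(p <- s) `[p.1, p.2]%classic) `|`
      \big[setU/set0]_(p <- s) (B `&` `[p.1, p.2]%classic)))).
    apply: lebesgue_outer_le => x Bx.
    have [xs|] :=
      pselect ((\big[setU/set0]_(p <- s) `[p.1, p.2]%classic) x); last by left.
    by right; move: xs; rewrite -!bigcup_seq => -[p ps xp]; exists p.
  rewrite (le_trans (lebesgue_outerU _ _))// leeD//.
  rewrite (le_trans (lebesgue_outer_seq _ _ _))//.
  rewrite mulr_sumr -sumEFin big_seq [leRHS]big_seq.
  by apply: lee_sum => p /sP[].
suff : M <= 0 by move=> M0'; rewrite -BM; congr EFin; apply/le_anti/andP.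
rewrite leNgt; apply/negP => Mgt.
(* With this [e], [key] would bound the positive number [(1 - c) * M] by half of itself. *)
have := key ((1 - c) * M / 4); have : 0 < (1 - c) * M by rewrite mulr_gt0//; lra.
move: ((1 - c) * M) => z z0; have z4 : 0 < z / 4 by lra.
by move=> /(_ z4); lra.
Qed.

(** These are points at which [E] is porous. Comparing both ends of the gap with its length makes
    the condition independent of the side of [x] on which the gap lies. *)
Definition gap_set (E : set R) (k : R) : set R :=
  [set x | E x /\ forall d : R, 0 < d -> exists a b : R,
    [/\ a < b, `|a - x| < d /\ `|b - x| < d,
        k * `|a - x| <= b - a /\ k * `|b - x| <= b - a &
        forall y, E y -> ~ (a < y < b)]].

(** The interval from [x] to the far end of a gap has at least the fraction [k] of its length in the
    gap, so at most the fraction [1 - k] is left for [E]. *)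
Lemma proportional_gaps_null (E : set R) (k : R) : (mu E < +oo)%E ->
  0 < k <= 1 ->
  mu (gap_set E k) = 0%E.
Proof.
move=> Eoo /andP[k0 k1]; set B := gap_set E k.
apply: (@locally_thin_null _ (1 - k)).
- by apply: le_lt_trans Eoo; apply: lebesgue_outer_le => x [].
- by apply/andP; split; lra.
move=> x [Ex gaps] d d0.
have [a [b [ab [ad bd] [ak bk] noE]]] := gaps _ d0.
(* [[u, v]] will be the interval from [x] to the far end, [[w, z]] what the gap leaves of it; the
   ends of the gap may lie in [E] but form a null set. *)
have thin u v w z : u < v -> w <= z -> `[u, v]%classic `\` `]a, b[%classic
    `<=` `[w, z]%classic `|` (a |` [set b])%classic ->
    z - w <= (1 - k) * (v - u) ->
    (mu (B `&` `[u, v]%classic) <= ((1 - k) * (v - u))%:E)%E.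
  move=> uv wz sub le.
  apply: (@le_trans _ _ (mu (`[w, z]%classic `|` ([set a] `|` [set b])))).
    apply: lebesgue_outer_le => y [[Ey _] yuv]; apply: sub; split => //=.
    by rewrite in_itv/=; exact: noE.
  rewrite (le_trans (lebesgue_outerU _ _))// lebesgue_measure_cc//.
  apply: (@le_trans _ _ ((z - w)%:E + 0)%E); last by rewrite adde0 lee_fin.
  rewrite leeD2l// (le_trans (lebesgue_outerU _ _))//.
  by rewrite !lebesgue_measure_set1 adde0.
have [xa|ax] := leP x a.
  rewrite !ger0_norm in ad bd ak bk; [|lra..].
  exists x, b; split; [|lra|by apply/andP; split; lra|lra].
  apply: (thin _ _ x a) => //; [lra| |lra].
  move=> y /= []; rewrite !in_itv/= => /andP[xy yb] /negP.
  rewrite negb_and -!leNgt => /orP[ya|by_]; first by left; rewrite xy.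
  by right; right; apply/le_anti/andP.
have bx : b <= x by rewrite leNgt; apply/negP => xb; apply: (noE _ Ex); rewrite ax.
rewrite !ler0_norm in ad bd ak bk; [|lra..].
exists a, x; split; [|lra|by apply/andP; split; lra|lra].
apply: (thin _ _ b x) => //; [|lra].
move=> y /= []; rewrite !in_itv/= => /andP[ay yx] /negP.
rewrite negb_and -!leNgt => /orP[ya|by_]; last by left; rewrite by_.
by right; left; apply/le_anti/andP.
Qed.

(** * Oscillation of difference quotients along a set with a Lipschitz bound *)

Context {X : normedModType R}.
Implicit Types (f : R -> X) (E : set R).

Definition oscillation_set f E (p q : R) : set R :=
  [set x | [/\ E x,
    forall d : R, 0 < d -> exists y, [/\ E y, 0 < `|y - x| < d &
      `|f y - f x| <= p * `|y - x|] &
    forall d : R, 0 < d -> exists y, [/\ E y, 0 < `|y - x| < d &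
      q * `|y - x| <= `|f y - f x|]]].

(* Cross each interval of [s] at slope [p] and the complement at slope [L]. *)
Lemma lipschitz_chain f E (L p : R) (s : seq (R * R)) (a b : R) :
  (forall x y, E x -> E y -> x <= y -> `|f y - f x| <= L * (y - x)) ->
  E a -> E b -> a <= b -> pairwise itv_before s ->
  (forall i, i \in s -> [/\ E i.1, E i.2, a <= i.1 < i.2, i.2 <= b &
    `|f i.2 - f i.1| <= p * (i.2 - i.1)]) ->
  `|f b - f a| <= L * (b - a) - (L - p) * \sum_(i <- s) (i.2 - i.1).
Proof.
move=> lipf; elim: s a => [|j s IH] a Ea Eb ab.
  by move=> _ _; rewrite big_nil mulr0 subr0; exact: lipf.
rewrite pairwise_cons => /andP[/allP js pws] sP.
have [Ej1 Ej2 /andP[aj j12] jb fj] := sP j (mem_head _ _).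
have := IH _ Ej2 Eb jb pws; rewrite big_cons => IH'.
have : `|f b - f j.2| <=
    L * (b - j.2) - (L - p) * \sum_(i <- s) (i.2 - i.1).
  apply: IH' => i si; have [|Ei1 Ei2 /andP[_ i12] ib fi] := sP i.
    by rewrite inE si orbT.
  by split => //; rewrite i12 andbT ltW//; exact: js.
have := lipf _ _ Ea Ej1 aj.
have -> : f b - f a = (f b - f j.2) + ((f j.2 - f j.1) + (f j.1 - f a)).
  by rewrite (addrA (f j.2 - f j.1)) subrK addrA subrK.
have := ler_normD (f b - f j.2) ((f j.2 - f j.1) + (f j.1 - f a)).
have := ler_normD (f j.2 - f j.1) (f j.1 - f a).
move: fj (\sum_(i <- s) (i.2 - i.1)) => fj S.
move=> h1 h2 h3 h4; lra.
Qed.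

(* On an interval across which [f] has slope at least [q], a Vitali cover by
   intervals of slope at most [p] cannot fill more than the fraction
   (K - q) / (K - p) of the length: the set is thin there. *)
Lemma quotient_oscillation_null f E (L p q : R) :
  (forall x y, E x -> E y -> x <= y -> `|f y - f x| <= L * (y - x)) ->
  (mu E < +oo)%E -> p < q ->
  mu (oscillation_set f E p q) = 0%E.
Proof.
move=> lipL Eoo pq; set B := oscillation_set f E p q.
have itvP x y : E x -> E y -> 0 < `|y - x| ->
    exists a b, [/\ E a, E b, a < b, a <= x <= b & b - a = `|y - x| /\
      `|f b - f a| = `|f y - f x|].
  move=> Ex Ey; rewrite normr_gt0 subr_eq0 neq_lt => /orP[yx|xy].
    exists y, x; split => //; first by rewrite (ltW yx) lexx.
    by split; rewrite distrC// gtr0_norm ?subr_gt0.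
  by exists x, y; split => //; [rewrite (ltW xy) lexx|rewrite gtr0_norm ?subr_gt0].
(* [K] exceeds both [L] and [q], which puts [(K - q) / (K - p)] in [[0, 1[]. *)
pose K := Num.max L q + 1.
have [LK qK] : L < K /\ q < K.
  by split; rewrite /K ltr_pwDr// le_max lexx ?orbT.
have lipf x y : E x -> E y -> x <= y -> `|f y - f x| <= K * (y - x).
  move=> Ex Ey xy; rewrite (le_trans (lipL _ _ Ex Ey xy))// ler_wpM2r ?(ltW LK)//.
  by rewrite subr_ge0.
have Kp : 0 < K - p by lra.
apply: (@locally_thin_null _ ((K - q) / (K - p))).
- by apply: le_lt_trans Eoo; apply: lebesgue_outer_le => x [].
- by rewrite ltr_pdivrMr// mul1r divr_ge0 ?(ltW Kp)//=; lra.
move=> x [Ex _ big] d d0.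
have [y [Ey /andP[xy yd] qf]] := big _ d0.
have [a [b [Ea Eb ab axb [abE fabE]]]] := itvP _ _ Ex Ey xy.
exists a, b; split => //; last by rewrite abE.
rewrite -abE -fabE in qf; apply/lee_addgt0Pr => e e0.
(* The ends are dropped so that small intervals fit inside []a, b[]; they return below as a null
   set. *)
pose A := B `&` `]a, b[%classic.
pose F u v := [/\ E u, E v & `|f v - f u| <= p * (v - u)].
have oU : open `]a, b[%classic by exact: interval_open.
have Uoo : (mu `]a, b[%classic < +oo)%E.
  by rewrite lebesgue_measure_itv/= lte_fin ab -EFinB ltry.
have fine z : A z -> forall d : R, 0 < d -> exists u v : R,
    [/\ F u v, u < v, u <= z <= v & v - u < d].
  move=> [[Ez small _] _] d' d'0.
  have [w [Ew /andP[zw wd] fw]] := small _ d'0.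
  have [u [v [Eu Ev uv uzv [uvE fuvE]]]] := itvP _ _ Ez Ew zw.
  by exists u, v; split => //; [rewrite /F uvE fuvE|rewrite uvE].
have [s [pws sP As]] := vitali_itv A `]a, b[%classic F e
  oU Uoo (@subIsetr _ _ _) fine e0.
(* The increment over [[a, b]] is at least [q * (b - a)], and the chain estimate bounds it above;
   solve for the sum. *)
have sumle : \sum_(i <- s) (i.2 - i.1) <= (K - q) / (K - p) * (b - a).
  rewrite mulrAC ler_pdivlMr// mulrC.
  suff : `|f b - f a| <= K * (b - a) - (K - p) * \sum_(i <- s) (i.2 - i.1).
    by move: qf; lra.
  apply: (lipschitz_chain f E) => //; first exact: ltW.
  move=> i /sP[[Ei1 Ei2 fi] i12 iab].
  have /iab : `[i.1, i.2]%classic i.1 by rewrite /= in_itv/= lexx ltW.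
  rewrite /= in_itv/= => /andP[ai _].
  have /iab : `[i.1, i.2]%classic i.2 by rewrite /= in_itv/= lexx ltW.
  rewrite /= in_itv/= => /andP[_ ib].
  by split; rewrite // ?(ltW ib)// (ltW ai).
apply: (@le_trans _ _ (mu
  ((\big[setU/set0]_(i <- s) `[i.1, i.2]%classic `|` ([set a] `|` [set b]))
  `|` (A `\` \big[setU/set0]_(i <- s) `[i.1, i.2]%classic)))).
  apply: lebesgue_outer_le => z [Bz]; rewrite /= in_itv/= => /andP[az zb].
  have [zs|zs] :=
    pselect ((\big[setU/set0]_(p <- s) `[p.1, p.2]%classic) z); first by left; left.
  have [za|za] := eqVneq z a; first by left; right; left.
  have [zb'|zb'] := eqVneq z b; first by left; right; right.
  by right; split => //; split => //=; rewrite in_itv/= !lt_neqAle az zb zb' eq_sym za.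
rewrite (le_trans (lebesgue_outerU _ _))// leeD//.
rewrite (le_trans (lebesgue_outerU _ _))//.
have -> : mu ([set a] `|` [set b]) = 0%E.
  apply/le_anti; rewrite measure_ge0 andbT (le_trans (lebesgue_outerU _ _))//.
  by rewrite !lebesgue_measure_set1 adde0.
rewrite adde0 (le_trans (lebesgue_outer_seq _ _ _))//.
apply: (@le_trans _ _ (\sum_(i <- s) (i.2 - i.1))%:E); last by rewrite lee_fin.
rewrite -sumEFin big_seq [leRHS]big_seq.
apply: lee_sum => i /sP[_ i12 _].
by rewrite lebesgue_measure_cc// ltW.
Qed.

End NullSets.

(** * Lipschitz pieces, and the passage from quotients along a piece to the metric derivative *)

Section MetricDerivative.
Context {R : realType} {X : normedModType R}.
Local Notation mu := (@lebesgue_measure R).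
Implicit Types (f : R -> X) (x : R).

Lemma negligible_countable_union (I : countType) (F : I -> set R) :
  (forall i, mu.-negligible (F i)) -> mu.-negligible (\bigcup_i F i).
Proof.
move=> F0; apply: (@negligibleS _ _ _ (@lebesgue_measure R)
    (\bigcup_k (if unpickle k is Some i then F i else set0))).
  by move=> x [i _ Fx]; exists (pickle i) => //; rewrite pickleK.
apply: negligible_bigcup => k.
by case: unpickle => [i|]; [exact: F0|exact: negligible_set0].
Qed.

(** A single [n] provides both the bound and the radius, so that countably many pieces will
    suffice. *)
Lemma limf_esup_right_bound (g : R -> R) :
  (limf_esup (fun t => (g t)%:E) 0^'+ < +oo)%E ->
  exists n : nat, forall t, 0 < t < n.+1%:R^-1 -> g t <= n%:R.
Proof.
rewrite /limf_esup => /ereal_inf_lt[_ [V V0 <-] Voo].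
have [d /= d0 dV] : exists2 d : R, 0 < d & forall t, 0 < t < d -> V t.
  move: V0; rewrite /nbhs/= /at_right /within/= => /nbhs_ballP[d /= d0 dV].
  exists d => // t /andP[t0 td]; apply: dV => //=.
  by rewrite /ball/= sub0r normrN gtr0_norm.
have [M gM] : exists M : R, forall t, V t -> g t <= M.
  move: Voo; case sE : (ereal_sup _) => [M| |]// _.
    by exists M => t Vt; rewrite -lee_fin -sE ereal_sup_ubound//; exists t.
  (* A supremum equal to [-oo] leaves no point in [V], so any bound will do. *)
  exists 0 => t Vt.
  have : ((g t)%:E <= -oo)%E by rewrite -sE ereal_sup_ubound//; exists t.
  by [].
pose n := (Num.truncn (Num.max M d^-1)).+1.
have nM : Num.max M d^-1 < n%:R by exact: truncnS_gt.
exists n => t /andP[t0 tn].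
have Mn : M <= n%:R by rewrite (le_trans _ (ltW nM))// le_max lexx.
rewrite (le_trans (gM _ _))//; apply: dV; rewrite t0 (lt_le_trans tn)//.
rewrite invf_ple ?posrE// (@le_trans _ _ n%:R)// ?ler_nat//.
by rewrite (le_trans _ (ltW nM))// le_max lexx orbT.
Qed.

(** The sign [s], equal to [1] or [-1], lets one definition serve both sides. *)
Definition lip_side f (s L h : R) : set R :=
  [set x | forall t : R, 0 < t < h -> `|f (x + s * t) - f x| <= L * t].

(* The radius makes any two points of a piece comparable through [lip_side],
   whichever side [s] selects. *)
Definition lip_piece f (s L h : R) (r : rat) : set R :=
  lip_side f s L h `&` ball (ratr r : R) (h / 2).

(** Points of a piece are less than [h] apart; the one-sided bound is used at [x] going right if
    [s = 1], at [y] going left if [s = -1]. *)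
Lemma lip_piece_lipschitz f (s L h : R) r : s = 1 \/ s = -1 ->
  forall x y, lip_piece f s L h r x -> lip_piece f s L h r y -> x <= y ->
    `|f y - f x| <= L * (y - x).
Proof.
move=> s1 x y [fx xr] [fy yr]; rewrite le_eqVlt => /predU1P[->|xy].
  by rewrite !subrr normr0 mulr0.
have xyn : 0 < y - x < h.
  move: xr yr; rewrite /ball/= !ltr_norml => /andP[? ?] /andP[? ?].
  by apply/andP; split; lra.
case: s1 fx fy => -> fx fy.
  by have := fx _ xyn; rewrite mul1r (addrC x) subrK.
have := fy _ xyn; rewrite mulN1r opprB (addrC y) subrK distrC.
exact.
Qed.

(** The limit is the lower limit along [E]. If the quotients did not eventually stay below a
    rational [q] just above it, then [x] would be in the oscillation set of [p] and [q] for a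
    rational [p] in between. *)
Lemma cvg_along_set f (E : set R) (L x : R) : E x ->
  (forall x y, E x -> E y -> x <= y -> `|f y - f x| <= L * (y - x)) ->
  (forall d : R, 0 < d -> exists2 y, E y & 0 < `|y - x| < d) ->
  (forall p q : rat, (p < q)%R -> ~ oscillation_set f E (ratr p) (ratr q) x) ->
  exists l : R, forall e : R, 0 < e -> exists2 d : R, 0 < d &
    forall y, E y -> 0 < `|y - x| < d ->
      `| `|f y - f x| / `|y - x| - l| <= e.
Proof.
move=> Ex lipf acc nosc.
(* The eventual lower bounds of the quotients; they are at most [L] because [x] is an accumulation
   point of [E]. *)
pose S : set R := [set q | exists2 d : R, 0 < d & forall y, E y ->
  0 < `|y - x| < d -> q <= `|f y - f x| / `|y - x|].
have S0 : S 0 by exists 1 => // y _ _; rewrite divr_ge0.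
have SL : ubound S L.
  move=> q [d d0 qd]; have [y Ey xyd] := acc _ d0.
  rewrite (le_trans (qd _ Ey xyd))//.
  have /andP[xy _] := xyd; rewrite ler_pdivrMr//.
  have [yx|yx] := leP y x.
    by have := lipf _ _ Ey Ex yx; rewrite distrC => /le_trans; apply;
      rewrite distrC ger0_norm ?subr_ge0.
  by have := lipf _ _ Ex Ey (ltW yx); rewrite ger0_norm// subr_ge0 ltW.
have hS : has_sup S by split; [exists 0|exists L].
exists (sup S) => e e0.
have [q1 [d1 d10 qd1] q1S] := sup_adherent e0 hS.
have [|p] := @rat_in_itvoo R (sup S) (sup S + e); first by lra.
rewrite in_itv/= => /andP[Sp pe].
have [|q] := @rat_in_itvoo R (ratr p) (sup S + e); first by [].
rewrite in_itv/= => /andP[pq qe].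
have nSp : ~ S (ratr p) by move=> /(sup_upper_bound hS); lra.
have low d : 0 < d -> exists y, [/\ E y, 0 < `|y - x| < d &
      `|f y - f x| <= ratr p * `|y - x|].
  move=> d0; apply: contrapT => no; apply: nSp; exists d => // y Ey xyd.
  rewrite leNgt; apply/negP => lt; apply: no; exists y; split => //.
  by have /andP[xy _] := xyd; rewrite -ler_pdivrMr// ltW.
have [d2 d20 qd2] : exists2 d : R, 0 < d & forall y, E y -> 0 < `|y - x| < d ->
    `|f y - f x| / `|y - x| <= ratr q.
  apply: contrapT => no; have pq' : (p < q)%R by rewrite -(ltr_rat R).
  apply: (nosc _ _ pq'); split => // d d0.
  apply: contrapT => no'; apply: no; exists d => // y Ey xyd.
  rewrite leNgt; apply/negP => lt; apply: no'; exists y; split => //.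
  by have /andP[xy _] := xyd; rewrite -ler_pdivlMr// ltW.
exists (Num.min d1 d2); first by rewrite lt_min d10.
move=> y Ey; rewrite lt_min => /and3P[xy y1 y2].
have h1 : q1 <= `|f y - f x| / `|y - x| by apply: qd1; rewrite // xy.
have h2 : `|f y - f x| / `|y - x| <= ratr q by apply: qd2; rewrite // xy.
by rewrite ler_norml; apply/andP; split; lra.
Qed.

(** With [w] the distance from [y] to [x], an interval of length [k * w] ending at [y] has its ends
    within [2 * w] of [x], so it cannot be a gap for the constant [k / 2]. It is placed on the side
    of [y] from which [lip_side] reaches [y], which need not be in the piece. *)
Lemma gap_approx f (s L h : R) r x (k : R) : 0 <= L -> 0 < h -> s = 1 \/ s = -1 ->
  lip_piece f s L h r x -> 0 < k <= 1 / 2 ->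
  ~ gap_set (lip_piece f s L h r) (k / 2) x ->
  exists2 d : R, 0 < d & forall y, 0 < `|y - x| < d ->
    exists e, [/\ lip_piece f s L h r e, `|y - e| <= k * `|y - x| &
      `|f y - f e| <= L * k * `|y - x|].
Proof.
move=> L0 h0 s1; set E := lip_piece f s L h r => Ex /andP[k0 k12] ngap.
have [d d0 nd] : exists2 d : R, 0 < d & forall a b : R, a < b ->
    `|a - x| < d -> `|b - x| < d ->
    k / 2 * `|a - x| <= b - a -> k / 2 * `|b - x| <= b - a ->
    exists2 y, E y & a < y < b.
  apply: contrapT => no; apply: ngap; split => // d d0.
  apply: contrapT => no'; apply: no; exists d => // a b ab ad bd ak bk.
  apply: contrapT => no2; apply: no'; exists a, b; split => // y Ey yab.
  by apply: no2; exists y.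
(* [d / 2] brings the ends of that interval within [d] of [x]; [h] keeps [y] in the range of the
   one-sided bound at [e]. *)
exists (Num.min (d / 2) h); first by rewrite lt_min h0 andbT; lra.
move=> y; rewrite lt_min => /and3P[xy yd yn].
set w := `|y - x| in xy yd yn *.
have hE : y - x = w \/ y - x = - w.
  by rewrite /w; case: (ger0P (y - x)) => _; [left|right; rewrite opprK].
have kh : 0 < k * w <= w / 2.
  by rewrite mulr_gt0//=; rewrite mulrC ler_pM2l//; lra.
have bound z : `|z - y| <= k * w -> `|z - x| <= 2 * w.
  move=> zy; rewrite -(subrK y z) -addrA (le_trans (ler_normD _ _))//.
  by rewrite -/w; move: kh => /andP[_ kh]; lra.
have kbound z : `|z - y| <= k * w -> k / 2 * `|z - x| <= k * w.
  by move=> /bound zx; have := ler_wpM2l (ltW k0) zx; lra.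
have bnd z : `|z - y| <= k * w -> `|z - x| < d by move=> /bound zx; lra.
move: kh => /andP[kh0 kh].
have yy : `|y - y| <= k * w by rewrite subrr normr0 ltW.
case: s1 => sE.
- have zy : `|y - k * w - y| <= k * w.
    by rewrite addrAC subrr add0r normrN gtr0_norm.
  have [|||||e Ee /andP[e1 e2]] := nd (y - k * w) y.
  + lra.
  + exact: bnd.
  + exact: bnd.
  + by rewrite subKr; exact: kbound.
  + by rewrite subKr; exact: kbound.
  exists e; split => //; first by rewrite gtr0_norm; lra.
  have [fe _] := Ee; have := fe (y - e); rewrite sE mul1r (addrC e) subrK => fe'.
  rewrite (le_trans (fe' _))//; first by apply/andP; split; lra.
  by rewrite -mulrA ler_wpM2l//; lra.
- have zy : `|y + k * w - y| <= k * w.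
    by rewrite addrAC subrr add0r gtr0_norm.
  have [|||||e Ee /andP[e1 e2]] := nd y (y + k * w).
  + lra.
  + exact: bnd.
  + exact: bnd.
  + by rewrite [leRHS](addrAC) subrr add0r; exact: kbound.
  + by rewrite [leRHS](addrAC) subrr add0r; exact: kbound.
  exists e; split => //; first by rewrite ltr0_norm; lra.
  have [fe _] := Ee; have := fe (e - y).
  rewrite sE mulN1r opprB (addrC e (y - e)) subrK => fe'.
  rewrite (le_trans (fe' _))//; first by apply/andP; split; lra.
  by rewrite -mulrA ler_wpM2l//; lra.
Qed.

Lemma md_exists_of_cvg f x (l : R) :
  (forall e : R, 0 < e -> exists2 d : R, 0 < d &
    forall y, 0 < `|y - x| < d -> `| `|f y - f x| / `|y - x| - l| <= e) ->
  md_exists f x.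
Proof.
move=> lim_l.
have side (g : R -> R) (c : R) : c = 1 \/ c = -1 ->
    (forall t, g t = `|f (x + c * t) - f x| / t) -> g t @[t --> 0^'+] --> l.
  move=> c1 gE; apply/cvgrPdist_le => e e0.
  have [d d0 dl] := lim_l _ e0.
  near=> t.
  have t0 : 0 < t by [].
  have tE : `|x + c * t - x| = t.
    rewrite addrAC subrr add0r; case: c1 => ->; rewrite ?mul1r ?mulN1r ?normrN;
    by rewrite gtr0_norm.
  rewrite gE distrC; have := dl (x + c * t); rewrite tE; apply.
  by rewrite t0/=; near: t; exact: nbhs_right_lt.
have cp : mquot_plus f x t @[t --> 0^'+] --> l.
  by apply: (side _ 1) => [|t]; [left|rewrite mul1r].
have cm : mquot_minus f x t @[t --> 0^'+] --> l.
  by apply: (side _ (-1)) => [|t]; [right|rewrite mulN1r].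
split; first by apply/cvg_ex; exists l.
  by apply/cvg_ex; exists l.
by rewrite /md_plus /md_minus (cvg_lim _ cp)// (cvg_lim _ cm).
Unshelve. all: by end_near. Qed.

(** Rational parameters keep both unions countable. *)
Definition exceptional_set f (E : set R) : set R :=
  (\bigcup_(k : rat) [set x | 0 < (ratr k : R) <= 1 / 2 /\
     gap_set E (ratr k / 2) x]) `|`
  (\bigcup_(pq : rat * rat) [set x | pq.1 < pq.2 /\
     oscillation_set f E (ratr pq.1) (ratr pq.2) x]).

Lemma negligible_exceptional_set f (E : set R) (L : R) : (mu E < +oo)%E ->
  (forall x y, E x -> E y -> x <= y -> `|f y - f x| <= L * (y - x)) ->
  mu.-negligible (exceptional_set f E).
Proof.
move=> Eoo lipf.
(* For parameters outside the admissible range the set is empty. *)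
have guard (C : Prop) (P : set R) : (C -> mu P = 0%E) ->
    mu.-negligible [set x | C /\ P x].
  move=> CP; apply: negligible_lebesgue_outer; have [c|nc] := pselect C.
    by rewrite -[RHS](CP c); congr (mu _); apply/seteqP; split => [x []|x Px].
  by rewrite -[RHS](@measure0 _ _ _ mu); congr (mu _);
    apply/seteqP; split => // x [].
apply: negligibleU; apply: negligible_countable_union.
  move=> k; apply: guard => /andP[k0 k1]; apply: proportional_gaps_null => //.
  by apply/andP; split; lra.
move=> [p q]; apply: guard => /= pq; apply: (quotient_oscillation_null f E L) => //.
by rewrite ltr_rat.
Qed.

Lemma lip_piece_finite f (s L h : R) r : 0 < h ->
  (mu (lip_piece f s L h r) < +oo)%E.
Proof.
move=> h0; apply: (@le_lt_trans _ _ (mu (ball (ratr r : R) (h / 2)))).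
  by apply: lebesgue_outer_le => x [].
by rewrite lebesgue_measure_ball ?ltry//; lra.
Qed.

(** Any [y] near [x] has a point [z] of the piece at distance at most [k] times that of [y] to [x];
    the quotients at [y] and [z] differ by at most [2 * L * k], so convergence along the piece
    extends to all [y]. *)
Lemma md_exists_lip_piece f (s L h : R) r x : 0 <= L -> 0 < h ->
  s = 1 \/ s = -1 -> lip_piece f s L h r x ->
  ~ exceptional_set f (lip_piece f s L h r) x -> md_exists f x.
Proof.
move=> L0 h0 s1 Ex nexc; set E := lip_piece f s L h r in Ex nexc.
have approx (k : rat) : 0 < (ratr k : R) <= 1 / 2 -> exists2 d : R, 0 < d &
    forall y, 0 < `|y - x| < d -> exists e, [/\ E e,
      `|y - e| <= ratr k * `|y - x| & `|f y - f e| <= L * ratr k * `|y - x|].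
  move=> kb; apply: gap_approx => // gk; apply: nexc; left; exists k => //.
have lipf := @lip_piece_lipschitz f s L h r s1.
have near_x y e (k : R) : k <= 1 / 2 -> `|y - e| <= k * `|y - x| ->
    0 < `|y - x| -> 0 < `|e - x| < 2 * `|y - x|.
  move=> k12 ye xy.
  have kxy : k * `|y - x| <= `|y - x| / 2 by rewrite mulrC ler_pM2l//; lra.
  have := ler_distD e y x; have := ler_distD y e x; rewrite [ `|e - y| ]distrC.
  by move=> h1 h2; apply/andP; split; lra.
(* Approximating [x + t] from the piece gives a point other than [x], within [2 * t] of it. *)
have acc (d : R) : 0 < d -> exists2 y, E y & 0 < `|y - x| < d.
  move=> d0; have [|k] := @rat_in_itvoo R 0 (1 / 2); first by lra.
  rewrite in_itv/= => /andP[k0 k1].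
  have [|d' d'0 ap] := approx k; first by rewrite k0 ltW.
  pose t := Num.min d d' / 2.
  have [t0 td td'] : [/\ 0 < t, 2 * t <= d & 2 * t <= d'].
    by rewrite /t mulrCA divff// mulr1 !ge_min !lexx orbT divr_gt0// lt_min d0.
  have tE : `|x + t - x| = t by rewrite (addrC x) addrK gtr0_norm.
  have [|e [Ee ye _]] := ap (x + t); first by rewrite tE t0; lra.
  have := near_x _ _ _ (ltW k1) ye; rewrite tE => /(_ t0)/andP[xe ex].
  by exists e => //; rewrite xe; lra.
have [|l ql] := cvg_along_set f E L x Ex lipf acc.
  by move=> p q pq osc; apply: nexc; right; exists (p, q).
apply: (@md_exists_of_cvg _ _ l) => e e0.
(* Chosen to give [2 * L * k <= e / 2]; the [+ 1] covers [L = 0]. *)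
have L1 : 0 < 4 * (L + 1) by lra.
have [|k] := @rat_in_itvoo R 0 (Num.min (1 / 2) (e / (4 * (L + 1)))).
  by rewrite lt_min !divr_gt0.
rewrite in_itv/= lt_min => /and3P[k0 k12]; rewrite ltr_pdivlMr// => ke.
have [|d1 d10 ap] := approx k; first by rewrite k0 ltW.
have [|d2 d20 q2] := ql (e / 2); first by lra.
(* The halving is needed because [z] is only known to be within twice the distance of [y] from
   [x]. *)
exists (Num.min d1 (d2 / 2)); first by rewrite lt_min d10/=; lra.
move=> y; rewrite lt_min => /and3P[xy y1 y2].
have [|z [Ez yz fyz]] := ap y; first by rewrite xy.
have /andP[xz zx] := near_x _ _ _ (ltW k12) yz xy.
have zd : 0 < `|z - x| < d2 by rewrite xz; lra.
have := q2 z Ez zd.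
have fE : `| `|f y - f x| - `|f z - f x| | <= L * ratr k * `|y - x|.
  rewrite (le_trans _ fyz)// (le_trans (ler_dist_dist _ _))//.
  by rewrite opprB addrA subrK.
have wE : `| `|z - x| - `|y - x| | <= ratr k * `|y - x|.
  rewrite (le_trans _ yz)// (le_trans (ler_dist_dist _ _))//.
  by rewrite opprB addrA subrK distrC.
have QL : `|f z - f x| <= L * `|z - x|.
  have [zx'|xz'] := leP z x.
    by rewrite distrC [ `|z - x| ]distrC ger0_norm ?subr_ge0//; exact: lipf.
  by rewrite [ `|z - x| ]ger0_norm ?subr_ge0 ?(ltW xz')//; apply: lipf; rewrite ?ltW.
rewrite -ler_pdivrMr// in QL.
have Q0 : 0 <= `|f z - f x| / `|z - x| by rewrite divr_ge0.
set P := `|f y - f x| / `|y - x|; set Q := `|f z - f x| / `|z - x| in QL Q0 *.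
have PE : `|f y - f x| = P * `|y - x| by rewrite divfK// gt_eqF.
have QE : `|f z - f x| = Q * `|z - x| by rewrite divfK// gt_eqF.
rewrite {}PE {}QE in fE.
have PQ : `|P - Q| <= 2 * L * ratr k.
  rewrite -(ler_pM2r xy) -[X in _ * X <= _](gtr0_norm xy) -normrM.
  (* The first term is the change in the increment of [f], the second the change of denominator;
     each is at most [L * k] times the distance from [y] to [x]. *)
  have -> : (P - Q) * `|y - x| =
      (P * `|y - x| - Q * `|z - x|) + Q * (`|z - x| - `|y - x|) by ring.
  rewrite (le_trans (ler_normD _ _))//.
  have : `|Q * (`|z - x| - `|y - x|)| <= L * (ratr k * `|y - x|).
    by rewrite normrM (ger0_norm Q0) ler_pM.
  by move: fE => h1 h2; lra.
move=> Ql; rewrite (le_trans (ler_distD Q _ _))//.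
have : 2 * L * ratr k <= e / 2 by lra.
by move=> h3; lra.
Qed.
End MetricDerivative.

(** * The exceptional null set, assembled from countably many pieces *)

Theorem corollary3p6 (R : realType) (X : completeNormedModType R)
    (f : R -> X) :
  exists N : set R,
    (@lebesgue_measure R).-negligible N /\
    (forall x : R, ~ N x ->
       (Order.min (mD_minus f x) (mD_plus f x) < +oo)%E ->
       md_exists f x).
Proof.
pose L (n : nat) : R := n%:R; pose h (n : nat) : R := n.+1%:R^-1.
pose sgn (b : bool) : R := if b then 1 else -1.
have sgn1 b : sgn b = 1 \/ sgn b = -1 by case: b; [left|right].
have h0 n : 0 < h n by rewrite invr_gt0.
(* Indexed by the side, the common parameter of bound and radius, and the rational centre. *)
pose E (i : bool * nat * rat) :=
  lip_piece f (sgn i.1.1) (L i.1.2) (h i.1.2) i.2.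
exists (\bigcup_(i : bool * nat * rat) exceptional_set f (E i)); split.
  apply: negligible_countable_union => -[[b n] r].
  apply: (@negligible_exceptional_set _ _ _ _ (L n)).
    exact: lip_piece_finite.
  exact: lip_piece_lipschitz.
move=> x Nx mDoo.
have [b [n fx]] : exists b n, lip_side f (sgn b) (L n) (h n) x.
  move: mDoo; rewrite gt_min => /orP[|] /limf_esup_right_bound[n fn].
    exists false, n => t t0; have := fn _ t0; rewrite /mquot_minus mulN1r.
    by have /andP[? _] := t0; rewrite ler_pdivrMr.
  exists true, n => t t0; have := fn _ t0; rewrite /mquot_plus mul1r.
  by have /andP[? _] := t0; rewrite ler_pdivrMr.
(* A rational centre within [h n / 2] of [x] places [x] in a piece. *)
have [|r] := @rat_in_itvoo R (x - h n / 2) (x + h n / 2).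
  by have := h0 n; lra.
rewrite in_itv/= => /andP[r1 r2].
apply: (@md_exists_lip_piece _ _ f (sgn b) (L n) (h n) r) => //.
- by split => //; rewrite /ball/= ltr_norml; apply/andP; split; lra.
- by move=> Ex; apply: Nx; exists (b, n, r).
Qed.
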